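(* Let $p$ and $q$ be two nonnegative integers and let $\mathcal{D}(p,q)$ denote the set of Delannoy paths from $(0,0)$ to $(p,q)$. Then $$c_{p,q}=\sum_{L\in\mathcal{D}(p,q)}\omega(L),$$ where $c_{p,q}$ is the number of ssymmetric $(2p,2q)$ clans and $\omega(L)$ is the weight of $L$.
   Context: For nonnegative integers $p,q$ put $n=p+q$. A $(2p,2q)$ preclan is a string $c_1c_2\cdots c_{2n}$ whose entries are the symbols $+$, $-$ or natural numbers, such that the number of $+$'s minus the number of $-$'s equals $2p-2q$, and every number that appears in the string appears exactly twice. Two $(2p,2q)$ preclans are equivalent if they have the same signs in the same positions and the positions of the matching (equal) numbers are the same in both. A $(2p,2q)$ clan is an equivalence class of $(2p,2q)$ preclans. It is symmetric if a representing preclan $c_1\cdots c_{2n}$ is equivalent to its reversal $c_{2n}\cdots c_1$. A ssymmetric $(2p,2q)$ clan is a symmetric $(2p,2q)$ clan such that $c_i\ne c_{2n+1-i}$ whenever $c_i$ is a number. The number of ssymmetric $(2p,2q)$ clans is denoted $c_{p,q}$ (for all nonnegative $p,q$), with $c_{p,q}=1$ whenever $p=0$ or $q=0$. A Delannoy path in $\mathcal{D}(p,q)$ is a lattice path in $\mathbb{N}^2$ from $(0,0)$ to $(p,q)$ using the steps $E=(1,0)$, $N=(0,1)$ and $D=(1,1)$ only; it is written as a word $L=L_1L_2\cdots L_k$ of its successive steps, where each $L_i=((a,b),(c,d))$ records the starting and ending point of the step. The weight of a step is $$\mathrm{weight}(L_i)=\begin{cases}1 & \text{if } L_i=((a,b),(a+1,b));\\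 1 & \text{if } L_i=((a,b),(a,b+1));\\ 2(a+b+1) & \text{if } L_i=((a,b),(a+1,b+1)),\end{cases}$$ and $\omega(L)=\mathrm{weight}(L_1)\,\mathrm{weight}(L_2)\cdots\mathrm{weight}(L_k)$ (the empty path in $\mathcal{D}(0,0)$ has weight $1$). *)

(* Defs.v *)
From HB Require Import structures.
From mathcomp Require Import all_boot all_order all_algebra.

Set Implicit Arguments.
Unset Strict Implicit.
Unset Printing Implicit Defensive.

Local Open Scope quotient_scope.

Inductive symbol := Plus | Minus | Num of nat.

Definition symbol_code (x : symbol) : bool + nat :=
  match x with Plus => inl true | Minus => inl false | Num k => inr k end.

Definition symbol_decode (x : bool + nat) : symbol :=
  match x with inl b => if b then Plus else Minus | inr k => Num k end.

Lemma symbol_codeK : cancel symbol_code symbol_decode.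
Proof. by case. Qed.

HB.instance Definition _ := Countable.copy symbol (can_type symbol_codeK).

Definition is_num (x : symbol) : bool := if x is Num _ then true else false.

Definition is_preclan (p q : nat) (c : (2 * (p + q)).-tuple symbol) : bool :=
  ((#|[set i | tnth c i == Plus]|%:Z - #|[set i | tnth c i == Minus]|%:Z)%R
     == ((2 * p)%N%:Z - (2 * q)%N%:Z)%R)
  && [forall i, is_num (tnth c i)
        ==> (#|[set j | tnth c j == tnth c i]| == 2)].

Record preclan (p q : nat) : Type := Preclan {
  preclan_val :> (2 * (p + q)).-tuple symbol;
  _ : is_preclan preclan_val }.

HB.instance Definition _ p q := [isSub for @preclan_val p q].
HB.instance Definition _ p q := [Countable of preclan p q by <:].

Definition equivalent (m : nat) (c d : m.-tuple symbol) : bool :=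
  [&& [forall i, (tnth c i == Plus) == (tnth d i == Plus)],
      [forall i, (tnth c i == Minus) == (tnth d i == Minus)]
    & [forall i, forall j,
         (is_num (tnth c i) && (tnth c i == tnth c j))
         == (is_num (tnth d i) && (tnth d i == tnth d j))]].

Lemma equivalentP (m : nat) (c d : m.-tuple symbol) :
  reflect [/\ forall i, (tnth c i == Plus) = (tnth d i == Plus),
              forall i, (tnth c i == Minus) = (tnth d i == Minus)
            & forall i j, (is_num (tnth c i) && (tnth c i == tnth c j))
                        = (is_num (tnth d i) && (tnth d i == tnth d j))]
          (equivalent c d).
Proof.
apply: (iffP and3P) => [[/forallP P /forallP M /forallP W]|[P M W]].
  split=> [i|i|i j]; [exact: (eqP (P i)) | exact: (eqP (M i)) |].
  by have /forallP/(_ j)/eqP := W i.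
by split; apply/forallP => i; rewrite ?P ?M //; apply/forallP => j; rewrite W.
Qed.

Lemma equivalent_refl m : reflexive (@equivalent m).
Proof. by move=> c; apply/equivalentP. Qed.

Lemma equivalent_sym m : symmetric (@equivalent m).
Proof.
by move=> c d; apply/equivalentP/equivalentP => -[P M W]; split=> *;
   rewrite ?P ?M ?W.
Qed.

Lemma equivalent_trans m : transitive (@equivalent m).
Proof.
move=> d c e /equivalentP[P M W] /equivalentP[P' M' W'].
by apply/equivalentP; split=> *; rewrite ?P ?M ?W ?P' ?M' ?W'.
Qed.

Definition preclan_equivalent (p q : nat) : rel (preclan p q) :=
  fun c d => equivalent (val c) (val d).

Lemma preclan_equivalent_refl p q : reflexive (@preclan_equivalent p q).
Proof. by move=> c; apply: equivalent_refl. Qed.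

Lemma preclan_equivalent_sym p q : symmetric (@preclan_equivalent p q).
Proof. by move=> c d; apply: equivalent_sym. Qed.

Lemma preclan_equivalent_trans p q : transitive (@preclan_equivalent p q).
Proof. by move=> d c e; apply: equivalent_trans. Qed.

Canonical preclan_equiv_rel (p q : nat) :=
  EquivRel (@preclan_equivalent p q) (@preclan_equivalent_refl p q)
    (@preclan_equivalent_sym p q) (@preclan_equivalent_trans p q).

Definition clan (p q : nat) : Type := {eq_quot preclan_equiv_rel p q}.

HB.instance Definition _ p q := EqQuotient.on (clan p q).
HB.instance Definition _ p q := Choice.on (clan p q).
HB.instance Definition _ p q :=
  Countable.copy (clan p q) (can_type (@reprK _ (clan p q))).

(* Finiteness of [clan p q]: every preclan is equivalent to one in which each
   number is the index of a position carrying that number. *)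
Section ClanFinite.

Variables p q : nat.
Let m := 2 * (p + q).

Let label (c : m.-tuple symbol) (i : 'I_m) : 'I_m :=
  odflt i [pick j | tnth c j == tnth c i].

Let tnth_label c i : tnth c (label c i) = tnth c i.
Proof. by rewrite /label; case: pickP => [j /eqP|/(_ i)]; rewrite ?eqxx. Qed.

Let label_eq c i j : (label c i == label c j) = (tnth c i == tnth c j).
Proof.
apply/eqP/eqP => [e|e]; first by rewrite -(tnth_label c i) e tnth_label.
rewrite /label e; case: pickP => [//|/(_ j)]; by rewrite eqxx.
Qed.

Let code (c : m.-tuple symbol) : m.-tuple (bool + 'I_m) :=
  [tuple match tnth c i with
         | Plus => inl true | Minus => inl false | Num _ => inr (label c i)
         end | i < m].

Let decode (d : m.-tuple (bool + 'I_m)) : m.-tuple symbol :=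
  [tuple match tnth d i with
         | inl b => if b then Plus else Minus | inr j => Num (val j)
         end | i < m].

Let normal c := decode (code c).

Let tnth_normal c i :
  tnth (normal c) i = if is_num (tnth c i) then Num (label c i) else tnth c i.
Proof. by rewrite !tnth_mktuple; case: (tnth c i). Qed.

Let is_num_normal c i : is_num (tnth (normal c) i) = is_num (tnth c i).
Proof. by rewrite tnth_normal; case: ifP. Qed.

Let normal_eq c i j :
  (tnth (normal c) i == tnth (normal c) j) = (tnth c i == tnth c j).
Proof.
rewrite !tnth_normal.
case ci: (tnth c i) => [||a]; case cj: (tnth c j) => [||b] //=.
rewrite -ci -cj -label_eq; apply/eqP/eqP => [[]|->] //.
exact: val_inj.
Qed.

Let normal_equivalent c : equivalent (normal c) c.
Proof.
apply/equivalentP; split=> [i|i|i j]; last by rewrite is_num_normal normal_eq.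
  by rewrite tnth_normal; case: (tnth c i).
by rewrite tnth_normal; case: (tnth c i).
Qed.

Let normal_preclan (c : preclan p q) : @is_preclan p q (normal c).
Proof.
have /equivalentP[eP eM _] := normal_equivalent c.
have /andP[cPM /forallP c2] := valP c.
rewrite /is_preclan (eq_finset _ eP) (eq_finset _ eM) cPM /=.
apply/forallP => i; rewrite is_num_normal.
by rewrite (eq_finset _ (fun j => normal_eq c j i)).
Qed.

Let clan_code (C : clan p q) : m.-tuple (bool + 'I_m) := code (val (repr C)).

Let clan_decode (d : m.-tuple (bool + 'I_m)) : option (clan p q) :=
  omap (\pi_(clan p q)) (insub (decode d)).

Let clan_codeK : pcancel clan_code clan_decode.
Proof.
move=> C; rewrite /clan_decode /clan_code.
case: insubP => [c _ vc|]; last by rewrite normal_preclan.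
congr Some; rewrite -[RHS]reprK; apply/eqquotP.
by rewrite /= /preclan_equivalent vc normal_equivalent.
Qed.

HB.instance Definition _ : isFinite (clan p q) := PCanIsFinite clan_codeK.

End ClanFinite.

Definition preclan_symmetric (m : nat) (c : m.-tuple symbol) : bool :=
  equivalent c [tuple of rev c].

(* Positions are numbered from 0, so [rev_ord i] is the position written
   2n + 1 - i when they are numbered from 1. *)
Definition preclan_ssymmetric (m : nat) (c : m.-tuple symbol) : bool :=
  preclan_symmetric c
  && [forall i, is_num (tnth c i) ==> (tnth c i != tnth c (rev_ord i))].

Definition ssymmetric (p q : nat) (C : clan p q) : bool :=
  preclan_ssymmetric (val (repr C)).

Lemma tnth_rev_tuple (m : nat) (c : m.-tuple symbol) (i : 'I_m) :
  tnth [tuple of rev c] i = tnth c (rev_ord i).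
Proof.
rewrite !(tnth_nth Plus) /= nth_rev ?size_tuple //.
Qed.

Lemma preclan_ssymmetric_equivalent (m : nat) (c d : m.-tuple symbol) :
  equivalent c d -> preclan_ssymmetric c = preclan_ssymmetric d.
Proof.
have half : forall c d : m.-tuple symbol, equivalent c d ->
    preclan_ssymmetric c -> preclan_ssymmetric d.
  move=> {}c {}d e /andP[sc /forallP nc]; apply/andP; split.
    have er : equivalent [tuple of rev c] [tuple of rev d].
      have /equivalentP[P M W] := e.
      by apply/equivalentP; split=> *; rewrite !tnth_rev_tuple ?P ?M ?W.
    apply: equivalent_trans er; apply: equivalent_trans sc.
    by rewrite equivalent_sym.
  have /equivalentP[_ _ W] := e.
  apply/forallP => i; apply/implyP => ni; apply/negP => ei.
  have := W i (rev_ord i); rewrite ni ei => /andP[nci eci].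
  by have := nc i; rewrite nci eci.
move=> e; apply/idP/idP; apply: half => //; by rewrite equivalent_sym.
Qed.

Lemma ssymmetric_pi (p q : nat) (c : preclan p q) :
  ssymmetric (\pi_(clan p q) c)%qT = preclan_ssymmetric (val c).
Proof.
apply: preclan_ssymmetric_equivalent.
have : (repr (\pi_(clan p q) c) = c %[mod clan p q])%qT by rewrite reprK.
by move/eqquotP.
Qed.

Definition num_ssymmetric_clans (p q : nat) : nat :=
  #|[set C : clan p q | ssymmetric C]|.

Definition point : Type := (nat * nat)%type.

Inductive step := E | N | D.

Definition step_code (s : step) : 'I_3 :=
  match s with E => inord 0 | N => inord 1 | D => inord 2 end.

Definition step_decode (k : 'I_3) : step :=
  match val k with 0 => E | 1 => N | _ => D end.

Lemma step_codeK : cancel step_code step_decode.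
Proof. by case; rewrite /step_decode /= inordK. Qed.

HB.instance Definition _ := Finite.copy step (can_type step_codeK).

Definition move (x : point) (s : step) : point :=
  match s with
  | E => (x.1.+1, x.2)
  | N => (x.1, x.2.+1)
  | D => (x.1.+1, x.2.+1)
  end.

(* The word of letters [L], read from the point [x], as the sequence of its
   steps given by their starting and ending points. *)
Fixpoint steps (x : point) (L : seq step) : seq (point * point) :=
  if L is s :: L' then (x, move x s) :: steps (move x s) L' else [::].

Definition is_delannoy (p q : nat) (L : seq step) : bool :=
  foldl move (0, 0) L == (p, q).

Lemma size_delannoy (p q : nat) (L : seq step) :
  is_delannoy p q L -> size L <= p + q.
Proof.
have H : forall (x : point), x.1 + x.2 + size L
    <= (foldl move x L).1 + (foldl move x L).2.
  elim: L => [x|s L IH x] /=; first by rewrite addn0.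
  apply: leq_trans (IH _); rewrite addnS -addSn leq_add2r.
  by case: s; rewrite /= ?addnS ?addSn.
by move=> /eqP e; have := H (0, 0); rewrite e.
Qed.

(* By [size_delannoy], the bound p + q on the length excludes no path. *)
Definition delannoy (p q : nat) : {set {bseq p + q of step}} :=
  [set L : {bseq p + q of step} | is_delannoy p q L].

(* Only meant for the steps E, N and D between two points. *)
Definition weight (l : point * point) : nat :=
  let: ((a, b), z) := l in
  if z == (a.+1, b.+1) then 2 * (a + b + 1) else 1.

Definition omega (L : seq step) : nat :=
  \prod_(l <- steps (0, 0) L) weight l.

(* Main.v *)
Require Import Defs.
From mathcomp Require Import all_boot zify.

(** Read a clan as the function that sends a position to its sign or, when the
    position carries a number, to the other position with that number (its
    mate).  Equivalent preclans are exactly those with the same function, so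
    ssymmetric clans correspond to the functions on 2(p + q) positions that
    commute with the reversal [r], whose mates are mutual, and in which no
    position is mated with itself or with its mirror image
    ([num_ssymmetric_clansE]).

    Such functions make sense on any [r]-stable set A of positions, and they
    can be counted by looking at one position x of A.
    - If x carries a sign, so does [r x], and these two positions can be
      deleted; this lowers p by one for a plus and q by one for a minus.
    - If x is mated with y, then [r x] is mated with [r y], and the four
      positions can be deleted; this lowers both p and q by one.  As y ranges
      over A minus x and [r x], there are 2(p + q) - 2 possibilities for y.
    What was deleted can be put back in exactly one way
    ([card_pairings_agree]), so the number c(p, q) of these functions satisfies
      c(p, q) = c(p-1, q) + c(p, q-1) + 2(p+q-1) c(p-1, q-1),
    where terms with a negative argument are zero ([card_pairings_rec]).

    The weighted sum over Delannoy paths satisfies the same recurrence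
    ([delannoy_sum_rec]): a path to (p, q) is a path to (p-1, q), (p, q-1) or
    (p-1, q-1) followed by one step, and the step D from (p-1, q-1) has weight
    2((p-1) + (q-1) + 1) = 2(p+q-1).  Both sides are 1 at (0, 0), so they agree
    ([card_pairings]). *)

Set Implicit Arguments.
Unset Strict Implicit.
Unset Printing Implicit Defensive.

(** * Symmetric pairings and their recurrence *)

Section SymmetricPairings.

Variables (T : finType) (r : T -> T).
Implicit Types (A B : {set T}) (g h : {ffun T -> bool + T}).
Hypotheses (rK : involutive r) (r_neq : forall x, r x != x).

Definition mirror (z : bool + T) : bool + T :=
  match z with inl s => inl s | inr y => inr (r y) end.

(** The value [inl true] outside A is an arbitrary default: it makes a pairing
    of A a single function on T, and it is fixed by [mirror]. *)
Definition paired_at (A : {set T}) (g : {ffun T -> bool + T}) (x : T) : bool :=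
  if x \in A then
    match g x with
    | inl _ => true
    | inr y => [&& y \in A, y != x, y != r x & g y == inr x]
    end
  else g x == inl true.

Definition sym_pairing (A : {set T}) (g : {ffun T -> bool + T}) : bool :=
  [forall x, paired_at A g x && (g (r x) == mirror (g x))].

Definition stable (A : {set T}) := forall x, (r x \in A) = (x \in A).

(** A sign weighs 2 for itself and 0 for the opposite sign, a mated position
    weighs 1 for both.  On a set of 2(p + q) positions, having totals 4p for
    plus and 4q for minus says that pluses exceed minuses by 2p - 2q; unlike
    that difference, the two totals are additive in natural numbers, and they
    leave nothing to count once p or q would become negative. *)
Definition charge (s : bool) (z : bool + T) : nat :=
  match z with inl t => 2 * (t == s) | inr _ => 1 end.

Definition total (s : bool) (A : {set T}) (g : {ffun T -> bool + T}) : nat :=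
  \sum_(x in A) charge s (g x).

Definition glue (B : {set T}) (h g : {ffun T -> bool + T}) :
    {ffun T -> bool + T} :=
  [ffun z => if z \in B then h z else g z].

Definition agree (B : {set T}) (h g : {ffun T -> bool + T}) : bool :=
  [forall z in B, g z == h z].

Lemma sym_pairingP A g :
  reflect (forall x, paired_at A g x /\ g (r x) = mirror (g x))
          (sym_pairing A g).
Proof.
apply: (iffP forallP) => H x; first by have /andP[? /eqP] := H x.
by have [-> ->] := H x; rewrite eqxx.
Qed.

Lemma sym_pairing_out A g x : sym_pairing A g -> x \notin A -> g x = inl true.
Proof.
move=> /sym_pairingP/(_ x)[+ _] xA.
by rewrite /paired_at (negPf xA) => /eqP.
Qed.

Lemma sym_pairing_mate A g x y : sym_pairing A g -> g x = inr y ->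
  [/\ x \in A, y \in A, y != x, y != r x & g y = inr x].
Proof.
move=> /sym_pairingP/(_ x)[+ _] gx; rewrite /paired_at gx.
by case: ifP => // xA /and4P[? ? ? /eqP].
Qed.

Lemma sym_pairing_glue A B h g : B \subset A -> stable B ->
  sym_pairing B h -> sym_pairing (A :\: B) g -> sym_pairing A (glue B h g).
Proof.
move=> /subsetP BA Br hB gA; apply/sym_pairingP => x.
rewrite /paired_at !ffunE Br.
have [xB|xB] := boolP (x \in B).
  split; last by have /sym_pairingP/(_ x)[_ ->] := hB.
  rewrite (BA _ xB); case hx: (h x) => [//|y].
  have [_ yB -> -> hy] := sym_pairing_mate hB hx.
  by rewrite ffunE yB (BA _ yB) hy eqxx.
split; last by have /sym_pairingP/(_ x)[_ ->] := gA.
case: ifP => [xA|/negbT xA]; last first.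
  by rewrite (sym_pairing_out gA) // inE (negPf xA) andbF.
case gx: (g x) => [//|y].
have [_ + -> -> gy] := sym_pairing_mate gA gx.
by rewrite ffunE inE => /andP[/negPf -> ->]; rewrite gy eqxx.
Qed.

(** [sym_pairing_glue] and this lemma are the two directions of the removal of
    a block B that is mated within itself. *)
Lemma sym_pairing_erase A B h g : stable B ->
  sym_pairing B h -> agree B h g -> sym_pairing A g ->
  sym_pairing (A :\: B) (glue B [ffun=> inl true] g).
Proof.
move=> Br hB /forall_inP gh gA.
apply/sym_pairingP => x; rewrite /paired_at !ffunE Br inE.
have [xB|xB] := boolP (x \in B) => //=.
split; last by have /sym_pairingP/(_ x)[_ ->] := gA.
case: ifP => [xA|/negbT xA]; last by rewrite (sym_pairing_out gA).
case gx: (g x) => [//|y].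
have [_ yA -> -> gy] := sym_pairing_mate gA gx.
have yB : y \notin B.
  (* The point of B would be mated by h with x, which lies outside B. *)
  apply: contra xB => yB; have hy : h y = inr x by rewrite -(eqP (gh _ yB)).
  by have [] := sym_pairing_mate hB hy.
by rewrite ffunE inE (negPf yB) yA gy eqxx.
Qed.

Lemma total_setD s A B h g : B \subset A -> agree B h g ->
  total s A g = total s B h + total s (A :\: B) g.
Proof.
move=> BA /forall_inP gh; rewrite /total (big_setID B) (setIidPr BA) /=.
by congr (_ + _); apply: eq_bigr => x xB; rewrite (eqP (gh x xB)).
Qed.

(** The arguments [u] and [v] are the totals for plus and for minus. *)
Definition pairings (A : {set T}) (u v : nat) : {set {ffun T -> bool + T}} :=
  [set g | [&& sym_pairing A g, total true A g == u & total false A g == v]].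

(** Gluing with h is a bijection onto the pairings of A that extend h, with
    inverse the reset to the default on B; totals are shifted by those of h. *)
Lemma card_pairings_agree A B h u v : B \subset A -> stable B ->
    sym_pairing B h ->
  #|[set g in pairings A (total true B h + u) (total false B h + v) |
      agree B h g]| = #|pairings (A :\: B) u v|.
Proof.
move=> BA Br hB.
rewrite -(@card_in_imset _ _ (glue B h) (pairings (A :\: B) u v)); last first.
  move=> g1 g2; rewrite !inE => /andP[g1A _] /andP[g2A _] /ffunP e.
  apply/ffunP => x; have := e x; rewrite !ffunE; case: ifP => // xB _.
  by rewrite (sym_pairing_out g1A) ?(sym_pairing_out g2A) // inE xB.
have glueD s h' g : total s (A :\: B) (glue B h' g) = total s (A :\: B) g.
  by apply: eq_bigr => x; rewrite inE ffunE => /andP[/negPf ->].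
congr #|pred_of_set _|; apply/setP => g; apply/idP/imsetP.
  rewrite !inE => /andP[/and3P[gA gu gv] gh].
  exists (glue B [ffun=> inl true] g).
    rewrite inE (sym_pairing_erase Br hB) //= !glueD.
    by move: gu gv; rewrite !(total_setD _ BA gh) !eqn_add2l => -> ->.
  apply/ffunP => x; rewrite !ffunE; case: (boolP (x \in B)) => // xB.
  by have /forall_inP/(_ x xB)/eqP := gh.
move=> [{}g + ->]; rewrite !inE => /and3P[gA /eqP gu /eqP gv].
have gh : agree B h (glue B h g) by apply/forall_inP => x xB; rewrite ffunE xB.
by rewrite sym_pairing_glue //= gh !(total_setD _ BA gh) !glueD gu gv !eqxx.
Qed.

Lemma stableD A B : stable A -> stable B -> stable (A :\: B).
Proof. by move=> Ar Br x; rewrite !inE Ar Br. Qed.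

Lemma stable_pair x : stable [set x; r x].
Proof. by move=> z; rewrite !inE (can2_eq rK rK) (inj_eq (inv_inj rK)) orbC. Qed.

Lemma sub_pair A x : stable A -> x \in A -> [set x; r x] \subset A.
Proof. by move=> Ar xA; apply/subsetP => z /set2P[]->; rewrite ?Ar. Qed.

Lemma card_pair x : #|[set x; r x]| = 2.
Proof. by rewrite cards2 eq_sym r_neq. Qed.

(** By symmetry the sign at x determines the one at [r x], so B is the mirror
    pair of x; its two signs contribute 4 to the total of their kind. *)
Lemma card_pairings_sign A x (s : bool) u v : stable A -> x \in A ->
  #|[set g in pairings A (4 * s + u) (4 * ~~ s + v) | g x == inl s]| =
  #|pairings (A :\: [set x; r x]) u v|.
Proof.
move=> Ar xA; set B := [set x; r x].
pose h : {ffun T -> bool + T} := [ffun z => inl (if z \in B then s else true)].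
have tot t : total t B h = 4 * (s == t).
  transitivity (\sum_(z in B) 2 * (s == t)).
    by apply: eq_bigr => z zB; rewrite ffunE zB.
  by rewrite sum_nat_const card_pair mulnA.
have hB : sym_pairing B h.
  apply/sym_pairingP => z; rewrite /paired_at !ffunE stable_pair.
  by split=> //; case: (z \in B).
have Br := stable_pair x : stable B.
rewrite -(card_pairings_agree _ _ (sub_pair Ar xA) Br hB) !tot.
congr #|pred_of_set _|; apply/setP => g; rewrite !inE eqb_id eqbF_neg.
case: (boolP (sym_pairing A g)) => //= gA; congr (_ && _).
have /sym_pairingP/(_ x)[_ grx] := gA.
apply/eqP/forall_inP => [gx z|/(_ x)].
  by rewrite ffunE => zB; rewrite zB; case/set2P: zB => ->; rewrite ?grx gx.
by rewrite ffunE !inE eqxx => /(_ isT)/eqP.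
Qed.

(** By symmetry the mate y of x determines the mates on both mirror pairs, and
    the four mated positions contribute 4 to each total. *)
Lemma card_pairings_mate A x y u v : stable A -> x \in A ->
    y \in A :\: [set x; r x] ->
  #|[set g in pairings A (4 + u) (4 + v) | g x == inr y]| =
  #|pairings (A :\: [set x; r x] :\: [set y; r y]) u v|.
Proof.
move=> Ar xA /setDP[yA]; rewrite !inE negb_or => /andP[yx yrx].
set B := [set x; r x] :|: [set y; r y].
have ryx : r y != x by rewrite (can2_eq rK rK).
have ryrx : r y != r x by rewrite (inj_eq (inv_inj rK)).
(* The four positions are distinct. *)
have neqs := (negPf (r_neq x), negPf (r_neq y), negPf yx, negPf yrx,
              negPf ryx, negPf ryrx).
have neqs' : (x == y = false) * (r x == y = false) * (x == r y = false)
    * (r x == r y = false) * (x == r x = false) * (y == r y = false).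
  by do !split; rewrite eq_sym neqs.
pose h : {ffun T -> bool + T} := [ffun z =>
  if z == x then inr y else if z == y then inr x else
  if z == r x then inr (r y) else if z == r y then inr (r x) else inl true].
have hx : h x = inr y by rewrite ffunE eqxx.
have hy : h y = inr x by rewrite ffunE eqxx neqs.
have hrx : h (r x) = inr (r y) by rewrite ffunE eqxx ?neqs ?neqs'.
have hry : h (r y) = inr (r x) by rewrite ffunE eqxx ?neqs ?neqs'.
have h_out z : z \notin B -> h z = inl true.
  rewrite !inE !negb_or.
  move=> /andP[/andP[/negPf zx /negPf zrx] /andP[/negPf zy /negPf zry]].
  by rewrite ffunE zx zrx zy zry.
have Br : stable B by move=> z; rewrite in_setU [RHS]in_setU !stable_pair.
have hB : sym_pairing B h.
  apply/sym_pairingP => z; have [zB|zB] := boolP (z \in B); last first.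
    by rewrite /paired_at (negPf zB) !h_out // Br.
  split; last first.
    by move: zB => /setUP[] /set2P[]->; rewrite ?rK ?hx ?hy ?hrx ?hry /= ?rK.
  rewrite /paired_at zB; move: zB => /setUP[] /set2P[]->;
    by rewrite ?hx ?hy ?hrx ?hry !inE ?rK ?hx ?hy ?hrx ?hry !eqxx
               ?neqs ?neqs' ?orbT.
have BA : B \subset A by rewrite subUset !sub_pair.
have tot t : total t B h = 4.
  transitivity (\sum_(z in B) 1).
    by apply: eq_bigr => z /setUP[] /set2P[]->; rewrite ?hx ?hy ?hrx ?hry.
  rewrite sum1_card cardsU !card_pair (_ : _ :&: _ = set0) ?cards0 //.
  apply/setP => z; rewrite !inE; apply/negbTE/negP => /andP[/orP[]/eqP->];
    by rewrite ?neqs'.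
rewrite setDDl -/B -(card_pairings_agree _ _ BA Br hB) !tot.
congr #|pred_of_set _|; apply/setP => g; rewrite !inE.
case: (boolP (sym_pairing A g)) => //= gA; congr (_ && _).
apply/eqP/forall_inP => [gx z|/(_ x)]; last first.
  by rewrite hx !inE eqxx => /(_ isT)/eqP.
have [_ _ _ _ gy] := sym_pairing_mate gA gx.
have gr w : g (r w) = mirror (g w) by have /sym_pairingP/(_ w)[] := gA.
by move=> /setUP[] /set2P[]->; rewrite ?gr ?gx ?gy ?hx ?hy ?hrx ?hry.
Qed.

Lemma card_pairings_split A x u v : x \in A ->
  #|pairings A u v| =
    #|[set g in pairings A u v | g x == inl true]| +
    #|[set g in pairings A u v | g x == inl false]| +
    \sum_(y in A :\: [set x; r x]) #|[set g in pairings A u v | g x == inr y]|.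
Proof.
move=> xA; rewrite -sum1_card (partition_big (fun g => g x) predT) //=.
rewrite big_sumType big_bool /= !sum1dep_card; congr (_ + _).
rewrite (bigID (fun y => y \in A :\: [set x; r x])) /= [X in _ + X]big1 ?addn0.
  by apply: eq_bigr => y _; rewrite sum1dep_card.
move=> y yA; rewrite sum1dep_card; apply: eq_card0 => g; rewrite !inE.
apply/negP => /andP[/andP[gA _] /eqP gx].
have [_ yA' yx yrx _] := sym_pairing_mate gA gx.
by move: yA; rewrite !inE yA' (negPf yx) (negPf yrx).
Qed.

Lemma charge_total0 s A g x : x \in A -> total s A g = 0 -> charge s (g x) = 0.
Proof.
move=> xA /eqP; rewrite /total (big_rem x) ?mem_index_enum //= xA addn_eq0.
by case/andP=> /eqP.
Qed.

(** When p = 0, the total for plus is 0, and then every position of A is a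
    minus: the terms that would have used p - 1 count nothing.  Likewise for
    q = 0. *)
Lemma card_pairings_rec A x p q : stable A -> x \in A ->
  #|pairings A (4 * p) (4 * q)| =
    (if p is p'.+1 then
       #|pairings (A :\: [set x; r x]) (4 * p') (4 * q)| else 0) +
    (if q is q'.+1 then
       #|pairings (A :\: [set x; r x]) (4 * p) (4 * q')| else 0) +
    (if (p, q) is (p'.+1, q'.+1) then
       \sum_(y in A :\: [set x; r x])
         #|pairings (A :\: [set x; r x] :\: [set y; r y]) (4 * p') (4 * q')|
     else 0).
Proof.
move=> Ar xA; rewrite (card_pairings_split _ _ xA).
have none (z : bool + T) s : 0 < charge s z ->
    forall g, sym_pairing A g -> total s A g == 0 -> (g x == z) = false.
  move=> z0 g _ /eqP /(charge_total0 xA) gx; apply/eqP => e.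
  by rewrite -e gx in z0.
congr (_ + _ + _).
- case: p => [|p]; last first.
    by rewrite -(card_pairings_sign true _ _ Ar xA) /= muln1 muln0 mulnS.
  apply: eq_card0 => g; rewrite !inE; apply/negP.
  by move=> /andP[/and3P[gA gu _]]; rewrite (none _ true _ g gA gu).
- case: q => [|q]; last first.
    by rewrite -(card_pairings_sign false _ _ Ar xA) /= muln1 muln0 mulnS.
  apply: eq_card0 => g; rewrite !inE; apply/negP.
  by move=> /andP[/and3P[gA _ gv]]; rewrite (none _ false _ g gA gv).
case: p q => [|p] [|q]; last first.
  by apply: eq_bigr => y yA; rewrite -(card_pairings_mate _ _ Ar xA yA) !mulnS.
all: apply: big1 => y _; apply: eq_card0 => g; rewrite !inE; apply/negP.
all: move=> /andP[/and3P[gA gu gv]].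
- by rewrite (none _ false _ g gA gv).
- by rewrite (none _ true _ g gA gu).
by rewrite (none _ true _ g gA gu).
Qed.

Lemma card_pairings0 : #|pairings set0 0 0| = 1.
Proof.
rewrite (_ : pairings _ _ _ = [set [ffun=> inl true]]) ?cards1 //.
apply/setP => g; rewrite !inE /total !big_set0 !andbT; apply/idP/eqP => [gA|->].
  by apply/ffunP => x; rewrite ffunE (sym_pairing_out gA) ?inE.
by apply/sym_pairingP => x; rewrite /paired_at inE !ffunE.
Qed.

(** The count depends on A only through its size: after deletion the mates of x
    all leave sets of the same size, and there are [#|A| - 2] of them, which is
    the weight of a diagonal step. *)
Lemma card_pairings (F : nat -> nat -> nat) : F 0 0 = 1 ->
    (forall p q, 0 < p + q -> F p q =
       (if p is p'.+1 then F p' q else 0) + (if q is q'.+1 then F p q' else 0) +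
       (if (p, q) is (p'.+1, q'.+1) then 2 * (p' + q' + 1) * F p' q' else 0)) ->
  forall A p q, stable A -> #|A| = 2 * (p + q) ->
    #|pairings A (4 * p) (4 * q)| = F p q.
Proof.
move=> F00 Frec A p q; have [n] := ubnP #|A|.
elim: n A p q => // n IH A p q; rewrite ltnS => An Ar cA.
have [A0|/set0Pn[x xA]] := eqVneq A set0.
  move: cA; rewrite A0 cards0 => /esym/eqP; rewrite muln_eq0 addn_eq0 /=.
  by move=> /andP[/eqP-> /eqP->]; rewrite card_pairings0 F00.
have cAx : #|A :\: [set x; r x]| = #|A| - 2.
  by rewrite cardsD (setIidPr (sub_pair Ar xA)) card_pair.
have Arx := stableD Ar (stable_pair x).
have A0 : 0 < #|A| by apply/card_gt0P; exists x.
rewrite (card_pairings_rec _ _ Ar xA) Frec; last lia.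
congr (_ + _ + _).
- by case: p cA => // p cA; apply: IH => //; lia.
- by case: q cA => // q cA; apply: IH => //; lia.
case: p q cA => [|p] [|q] // cA.
rewrite (eq_bigr (fun _ => F p q)) => [|y yA].
  by rewrite sum_nat_const cAx cA; congr (_ * _); lia.
have cAxy : #|A :\: [set x; r x] :\: [set y; r y]| = #|A| - 4.
  by rewrite cardsD (setIidPr (sub_pair Arx yA)) card_pair cAx; lia.
by apply: IH; [lia|apply: stableD (stable_pair y)|lia].
Qed.

End SymmetricPairings.

(** * Delannoy paths by their last step *)

(** The paths to different endpoints live in types of bounded sequences with
    different bounds; as plain words they can be compared. *)
Definition delannoy_words (p q : nat) : seq (seq step) :=
  [seq val L | L <- enum (delannoy p q)].

Lemma mem_delannoy_words p q L : (L \in delannoy_words p q) = is_delannoy p q L.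
Proof.
apply/mapP/idP => [[w]|dL]; first by rewrite mem_enum inE => + ->.
exists (Bseq (size_delannoy dL)) => //; by rewrite mem_enum inE.
Qed.

Lemma uniq_delannoy_words p q : uniq (delannoy_words p q).
Proof. by rewrite (map_inj_uniq val_inj) enum_uniq. Qed.

Definition delannoy_sum (p q : nat) : nat := \sum_(L in delannoy p q) omega L.

Lemma delannoy_sumE p q (s : seq (seq step)) :
  uniq s -> s =i is_delannoy p q -> delannoy_sum p q = \sum_(L <- s) omega L.
Proof.
move=> su sE; rewrite /delannoy_sum -big_enum -(big_map val predT omega).
apply/perm_big/uniq_perm => // [|L]; first exact: uniq_delannoy_words.
by rewrite mem_delannoy_words sE.
Qed.

Lemma omega_rcons L s :
  omega (rcons L s) =
  omega L * weight (foldl move (0, 0) L, move (foldl move (0, 0) L) s).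
Proof.
rewrite /omega; elim: L (0, 0) => [|t L IH] x /=.
  by rewrite big_cons big_nil mulnC.
by rewrite !big_cons IH mulnA.
Qed.

Definition append (s : step) (p q : nat) : seq (seq step) :=
  [seq rcons L s | L <- delannoy_words p q].

Lemma mem_append s p q L t :
  (rcons L t \in append s p q) = (t == s) && is_delannoy p q L.
Proof.
rewrite -mem_delannoy_words; apply/mapP/andP => [[K wK]|[/eqP-> wL]].
  by move=> /rcons_inj[-> ->].
by exists L.
Qed.

Lemma nil_append s p q : ([::] \in append s p q) = false.
Proof. by apply/mapP => -[[|? ?] _]. Qed.

Lemma uniq_append s p q : uniq (append s p q).
Proof.
by rewrite map_inj_uniq ?uniq_delannoy_words // => K L /rcons_inj[].
Qed.

Lemma sum_append s p q :
  \sum_(L <- append s p q) omega L =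
  weight ((p, q), move (p, q) s) * delannoy_sum p q.
Proof.
rewrite big_map (@delannoy_sumE p q (delannoy_words p q)); last first.
- exact: mem_delannoy_words.
- exact: uniq_delannoy_words.
rewrite big_distrr big_seq [RHS]big_seq; apply: eq_bigr => L.
by rewrite mem_delannoy_words omega_rcons => /eqP ->; rewrite mulnC.
Qed.

Lemma weightE p q : weight ((p, q), move (p, q) E) = 1.
Proof. by rewrite /= xpair_eqE (ltn_eqF (ltnSn q)) andbF. Qed.

Lemma weightN p q : weight ((p, q), move (p, q) N) = 1.
Proof. by rewrite /= xpair_eqE (ltn_eqF (ltnSn p)). Qed.

Lemma weightD p q : weight ((p, q), move (p, q) D) = 2 * (p + q + 1).
Proof. by rewrite /= eqxx. Qed.

Lemma delannoy_sum00 : delannoy_sum 0 0 = 1.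
Proof.
rewrite (@delannoy_sumE 0 0 [:: [::]]) // => [|L].
  by rewrite big_seq1 /omega big_nil.
rewrite inE -topredE /=; apply/eqP/idP => [-> //|/size_delannoy].
by case: L.
Qed.

Lemma step_neq :
  ((E == N) = false) * ((E == D) = false) * ((N == E) = false)
  * ((N == D) = false) * ((D == E) = false) * ((D == N) = false).
Proof. by do !split; apply/eqP. Qed.

(** The words ending at (p, q) are sorted by their last letter, not by the
    first: the removal of the first step would move the start of all others,
    and with it the weight of the diagonal ones. *)
Lemma delannoy_sum_rec p q : 0 < p + q ->
  delannoy_sum p q =
    (if p is p'.+1 then delannoy_sum p' q else 0) +
    (if q is q'.+1 then delannoy_sum p q' else 0) +
    (if (p, q) is (p'.+1, q'.+1) then
       2 * (p' + q' + 1) * delannoy_sum p' q' else 0).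
Proof.
move=> pq0.
pose s := (if p is p'.+1 then append E p' q else [::]) ++
          (if q is q'.+1 then append N p q' else [::]) ++
          (if (p, q) is (p'.+1, q'.+1) then append D p' q' else [::]).
have sE : s =i is_delannoy p q.
  move=> L; rewrite -[RHS]topredE /= !mem_cat; case: (lastP L) => [|K t].
    move: pq0; rewrite /is_delannoy /=.
    by case: (p) (q) => [|p'] [|q']; rewrite ?nil_append.
  rewrite /is_delannoy foldl_rcons; case: t p q {s pq0} => [] [|p'] [|q'];
    rewrite ?mem_append /is_delannoy ?in_nil /=;
    by case: foldl => a b; rewrite !xpair_eqE /= ?step_neq
      ?eqxx ?eqSS ?orbF ?andbF ?andbT.
have su : uniq s.
  rewrite /s; case: p q {s pq0 sE} => [|p'] [|q']; rewrite ?cats0 ?uniq_append //=.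
  have disjoint t t' a b a' b' : t != t' ->
      ~~ has (mem (append t a b)) (append t' a' b').
    move=> tt'; apply/hasPn => L; case: (lastP L) => [|K r].
      by rewrite nil_append.
    rewrite mem_append => /andP[/eqP-> _].
    by rewrite -[X in ~~ X]/(_ \in append t a b) mem_append eq_sym (negPf tt').
  by rewrite !cat_uniq has_cat !uniq_append !negb_or !disjoint ?step_neq.
rewrite (delannoy_sumE su sE) !big_cat /= -addnA.
case: p q {s pq0 sE su} => [|p'] [|q'];
  by rewrite ?big_nil ?sum_append ?weightE ?weightN ?weightD ?mul1n.
Qed.

(** * Clans as symmetric pairings *)

Section Encoding.

Variable m : nat.
Implicit Types (c d : m.-tuple symbol) (g : {ffun 'I_m -> bool + 'I_m}).

Definition sign (s : bool) : symbol := if s then Plus else Minus.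

(** The last condition says both that j is the mate of i and that no third
    position carries the same number. *)
Definition encodes c g : Prop := forall i,
  match g i with
  | inl s => tnth c i = sign s
  | inr j => [/\ is_num (tnth c i), j != i &
                 forall k, (tnth c k == tnth c i) = (k == i) || (k == j)]
  end.

(** The function encoding a preclan is a complete invariant of its clan. *)
Lemma encodes_equivalent c d g f :
  encodes c g -> encodes d f -> equivalent c d = (g == f).
Proof.
move=> cg df; apply/equivalentP/eqP => [[P M W]|gf].
  apply/ffunP => i; have := (cg i, df i, P i, M i, W i); case: (g i) => [s|j].
    case: (f i) => [t|j] [[[[->]]]]; first by move=> ->; case: s t => [] [].
    by case: (tnth d i) s => [||?] [] // [].
  move=> [[[[[]]]]]; case: (tnth c i) => // a _ ji cj.
  case: (f i) => [t -> |l [d_num li dj] _ _ /(_ j)]; first by case: t.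
  by rewrite d_num (eq_sym _ (tnth c j)) (eq_sym _ (tnth d j)) cj dj eqxx
    (negPf ji) orbT => /esym /= /eqP->.
have cgdf i :
  [/\ (tnth c i == Plus) = (tnth d i == Plus),
      (tnth c i == Minus) = (tnth d i == Minus),
      is_num (tnth c i) = is_num (tnth d i) &
      is_num (tnth c i) ->
        forall j, (tnth c i == tnth c j) = (tnth d i == tnth d j)].
  have := (cg i, df i); rewrite -gf; case: (g i) => [s|l] [].
    by move=> -> ->; case: s.
  move=> [cn _ cl] [dn _ dl]; split.
  - by case: (tnth c i) cn (tnth d i) dn => [||?] // _ [||?].
  - by case: (tnth c i) cn (tnth d i) dn => [||?] // _ [||?].
  - by rewrite cn dn.
  - by move=> _ j; rewrite !(eq_sym _ (tnth _ j)) cl dl.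
split=> [i|i|i j]; have [P M n W] := cgdf i => //.
by rewrite -n; case: (boolP (is_num _)) => //= /W.
Qed.

Definition mates c : {ffun 'I_m -> bool + 'I_m} :=
  [ffun i => match tnth c i with
             | Plus => inl true
             | Minus => inl false
             | Defs.Num _ =>
                 inr (odflt i [pick j | (j != i) && (tnth c j == tnth c i)])
             end].

Lemma encodes_mates c :
    (forall i, is_num (tnth c i) -> #|[set j | tnth c j == tnth c i]| = 2) ->
  encodes c (mates c).
Proof.
move=> c2 i; rewrite ffunE; case ci: (tnth c i) => [||a] //.
have /eqP/cards2P[x [y [xy cE]]] : #|[set j | tnth c j == tnth c i]| = 2.
  by apply: c2; rewrite ci.
have cxy k : (tnth c k == tnth c i) = (k == x) || (k == y).
  by move/setP/(_ k): cE; rewrite !inE.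
wlog xi : x y xy {cE} cxy / x = i.
  move=> H; have := cxy i; rewrite eqxx => /esym/orP[/eqP e|/eqP e].
    exact: (H x y).
  by apply: (H y x) => //; [rewrite eq_sym|move=> k; rewrite cxy orbC].
move: xy cxy; rewrite {}xi => iy cxy; rewrite ci in cxy *.
case: pickP => [j /andP[ji cj]|/(_ y)] /=; last first.
  by rewrite cxy eqxx orbT eq_sym iy.
by move: cj; rewrite cxy (negPf ji) => /eqP jy; rewrite jy in ji *; split.
Qed.

(** The smaller of two mated positions serves as their common number. *)
Definition tuple_of g : m.-tuple symbol :=
  [tuple match g i with
         | inl s => sign s | inr j => Defs.Num (minn i j) end | i < m].

Lemma encodes_tuple_of g :
    (forall i j, g i = inr j -> j != i /\ g j = inr i) ->
  encodes (tuple_of g) g.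
Proof.
move=> gK i; case gi: (g i) => [s|j]; first by rewrite tnth_mktuple gi.
have [ji gj] := gK i j gi; split=> // [|k]; first by rewrite tnth_mktuple gi.
rewrite !tnth_mktuple gi; case gk: (g k) => [s|l].
  have ki : k != i by apply/eqP => e; move: gk; rewrite e gi.
  have kj : k != j by apply/eqP => e; move: gk; rewrite e gj.
  by rewrite (negPf ki) (negPf kj); case: (s).
have [lk gl] := gK k l gk.
apply/eqP/orP => [[e]|[]/eqP ek]; last 2 first.
- by move: gk; rewrite ek gi => -[->].
- by move: gk; rewrite ek gj => -[->]; rewrite minnC.
have: [|| k == i, k == j, l == i | l == j].
  by move: e; rewrite -!val_eqE /=; lia.
case/or4P => [->|->|/eqP li|/eqP lj]; [by left|by right|right|left].
  by move: gl; rewrite li gi => -[->].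
by move: gl; rewrite lj gj => -[->].
Qed.

End Encoding.

Section ClansAsPairings.

Variables p q : nat.
Implicit Types (c d : (2 * (p + q)).-tuple symbol).

Notation I := 'I_(2 * (p + q)).

Lemma rev_ord_neq (i : I) : rev_ord i != i.
Proof. by rewrite -val_eqE /=; have := ltn_ord i; lia. Qed.

Lemma encodes_rev c g : encodes c g ->
  encodes [tuple of rev c] [ffun i => mirror (@rev_ord _) (g (rev_ord i))].
Proof.
move=> cg i; rewrite ffunE; have := cg (rev_ord i); rewrite tnth_rev_tuple.
case: (g _) => [//|j] [cn ji cj] /=; split=> // [|k].
  by rewrite (can2_eq (@rev_ordK _) (@rev_ordK _)).
rewrite tnth_rev_tuple cj (inj_eq rev_ord_inj).
by rewrite (can2_eq (@rev_ordK _) (@rev_ordK _)).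
Qed.

(** Symmetry of the preclan says that g commutes with the mirror image; the
    condition on numbers says that no mate is the mirror image. *)
Lemma encodes_ssymmetric c g : encodes c g ->
  preclan_ssymmetric c = sym_pairing (@rev_ord _) setT g.
Proof.
move=> cg; rewrite /preclan_ssymmetric /preclan_symmetric.
rewrite (encodes_equivalent cg (encodes_rev cg)).
apply/andP/sym_pairingP => [[/eqP/ffunP gr /forall_inP nc] i|gP].
  split; last by rewrite gr ffunE rev_ordK.
  rewrite /paired_at inE; have := cg i; case gi: (g i) => [//|j] [cn ji cj].
  have cji : tnth c j = tnth c i by apply/eqP; rewrite cj eqxx orbT.
  rewrite inE ji /=; apply/andP; split.
    by apply: contraNneq (nc i cn) => <-; rewrite cji.
  have := cg j; case: (g j) => [s cs|l [_ lj cl]].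
    by move: cn; rewrite -cji cs; case: (s).
  by have := cl i; rewrite cji eqxx (eq_sym i) (negPf ji) => /esym /= /eqP->.
split.
  apply/eqP/ffunP => i; rewrite ffunE; have [_ <-] := gP (rev_ord i).
  by rewrite rev_ordK.
apply/forall_inP => i cn; have [+ _] := gP i; have := cg i.
rewrite /paired_at inE; case: (g i) => [s e|j [_ ji cj]].
  by move: cn; rewrite e; case: (s).
case/and4P=> _ _ jr _; rewrite eq_sym cj negb_or rev_ord_neq.
by rewrite eq_sym.
Qed.

(** In an encoded tuple numbers already come in pairs, so only the balance of
    signs is left; the length 2(p + q) turns it into the two totals. *)
Lemma encodes_preclan c g : encodes c g ->
  is_preclan c =
    (total true setT g == 4 * p) && (total false setT g == 4 * q).
Proof.
move=> cg; rewrite /is_preclan.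
have -> : [forall i, is_num (tnth c i)
             ==> (#|[set j | tnth c j == tnth c i]| == 2)].
  apply/forall_inP => i cn; have := cg i; case: (g i) => [s e|j [_ ji cj]].
    by move: cn; rewrite e; case: (s).
  rewrite (_ : [set _ | _] = [set i; j]); first by rewrite cards2 (eq_sym i) ji.
  by apply/setP => k; rewrite !inE cj.
rewrite andbT.
have countE (P : pred I) : #|[set i | P i]| = \sum_i P i.
  by rewrite -sum1dep_card big_mkcond; apply: eq_bigr => i _; case: (P i).
have tot s : total s setT g =
    2 * #|[set i | tnth c i == sign s]| + #|[set i | is_num (tnth c i)]|.
  rewrite !countE big_distrr -big_split.
  apply: eq_big => [i|i _] /=; first by rewrite inE.
  have := cg i.
  case: (g i) => [t ->|j [+ _ _]]; first by case: s t => [] [].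
  by case: (tnth c i) => // a _; case: s.
have all_pos : #|[set i | tnth c i == Plus]| + #|[set i | tnth c i == Minus]|
    + #|[set i | is_num (tnth c i)]| = 2 * (p + q).
  rewrite !countE -[RHS]card_ord -sum1_card -!big_split /=.
  by apply: eq_bigr => i _; case: (tnth c i).
rewrite !tot /=; move: all_pos; do 3 move: #|_|; lia.
Qed.

Lemma num_ssymmetric_clansE :
  num_ssymmetric_clans p q =
  #|pairings (@rev_ord _) [set: I] (4 * p) (4 * q)|.
Proof.
have enc (C : clan p q) : encodes (val (repr C)) (mates (val (repr C))).
  apply: encodes_mates => i cn.
  by have /andP[_ /forall_inP/(_ i cn)/eqP] := valP (repr C).
have mates_inj : injective (fun C : clan p q => mates (val (repr C))).
  move=> C1 C2 /eqP; rewrite -(encodes_equivalent (enc C1) (enc C2)) => e.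
  by rewrite -[C1]reprK -[C2]reprK; apply/eqquotP.
rewrite /num_ssymmetric_clans -(card_imset _ mates_inj).
congr #|pred_of_set _|; apply/setP => g; apply/imsetP/idP => [[C + ->]|].
  rewrite !inE /ssymmetric (encodes_ssymmetric (enc C)) => ->.
  by rewrite -(encodes_preclan (enc C)) valP.
rewrite inE => /and3P[gS gu gv].
have eg : encodes (tuple_of g) g.
  apply: encodes_tuple_of => i j gij.
  by have [_ _ ji _ gj] := sym_pairing_mate gS gij.
have cP : is_preclan (tuple_of g) by rewrite (encodes_preclan eg) gu.
pose c : preclan p q := Sub (tuple_of g) cP.
have ceq : equivalent (val (repr (\pi_(clan p q) c)%qT)) (tuple_of g).
  have : (repr (\pi_(clan p q) c) = c %[mod clan p q])%qT by rewrite reprK.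
  by move/eqquotP.
exists (\pi_(clan p q) c)%qT.
  by rewrite inE ssymmetric_pi (encodes_ssymmetric eg).
by apply/esym/eqP; rewrite -(encodes_equivalent (enc _) eg).
Qed.

End ClansAsPairings.

Theorem proposition1p22 (p q : nat) :
  num_ssymmetric_clans p q = \sum_(L in delannoy p q) omega L.
Proof.
rewrite num_ssymmetric_clansE.
apply: (card_pairings (@rev_ordK _) (@rev_ord_neq p q)
          delannoy_sum00 delannoy_sum_rec) => [x|].
  by rewrite !inE.
by rewrite cardsT card_ord.
Qed.
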